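(* Let $R\subset\mathbb{R}_{\ge 0}$ be a countable set containing $0$, and let $\mathcal{U}_R$ be the collection of all compact ultrametric spaces $(X,u_X)$ (up to isometry) with $\mathrm{spec}(X)\subset R$, endowed with the restriction of the Gromov-Hausdorff ultrametric $u_{\mathrm{GH}}$. Then $(\mathcal{U}_R,u_{\mathrm{GH}})$ is the $R$-Urysohn universal ultrametric space; that is, $(\mathcal{U}_R,u_{\mathrm{GH}})$ is an $R$-ultrametric space such that: (1) $(\mathcal{U}_R,u_{\mathrm{GH}})$ is Polish; (2) ($R$-universality) every Polish $R$-ultrametric space embeds isometrically into $(\mathcal{U}_R,u_{\mathrm{GH}})$; (3) ($R$-ultra-homogeneity) for every finite $R$-ultrametric space $B$, every subset $A\subset B$ and every isometric embedding $\varphi:A\to\mathcal{U}_R$, there exists an isometric embedding $\psi:B\to\mathcal{U}_R$ with $\psi|_A=\varphi$.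
   Context: An ultrametric space is a metric space $(X,u_X)$ satisfying the strong triangle inequality $u_X(x,z)\le\max(u_X(x,y),u_X(y,z))$ for all $x,y,z\in X$. A metric space is Polish if it is complete and separable. An isometric embedding is a distance-preserving map (not necessarily surjective). The spectrum of a metric space $(X,d_X)$ is $\mathrm{spec}(X):=\{d_X(x,x'):x,x'\in X\}$. An $R$-ultrametric space is an ultrametric space $X$ with $\mathrm{spec}(X)\subset R$. An $R$-ultrametric space is called an $R$-Urysohn universal ultrametric space if it is Polish, $R$-universal and $R$-ultra-homogeneous in the sense of (1)-(3); such a space is known to be unique up to isometry (Gao-Shao), which is the meaning of ''the''. For nonempty compact ultrametric spaces $X,Y$ (isometric spaces being identified), the Gromov-Hausdorff ultrametric is $$u_{\mathrm{GH}}(X,Y):=\inf_Z d_{\mathrm{H}}^Z(X,Y),$$ where the infimum is over all ultrametric spaces $Z$ and all isometric embeddings of $X$ into $Z$ and of $Y$ into $Z$, and $d_{\mathrm{H}}^Z$ is the Hausdorff distance in $Z$ between the images. It is known that $u_{\mathrm{GH}}$ is a complete ultrametric on the collection of (isometry classes of) compact ultrametric spaces. *)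

(* Defs.v *)
From HB Require Import structures.
From mathcomp Require Import all_boot all_order all_algebra.
From mathcomp Require Import boolp classical_sets cardinality reals topology.

Set Implicit Arguments.
Unset Strict Implicit.
Unset Printing Implicit Defensive.

Import Order.TTheory GRing.Theory Num.Theory.
Local Open Scope classical_set_scope.
Local Open Scope ring_scope.

(* [mspace h] is the library metric space with underlying set [T] and distance
   [d]; its topology and uniformity are those induced by [d]. *)
Record is_metric (K : realType) (T : Type) (d : T -> T -> K) : Prop := IsMetric {
  distxx : forall x, d x x = 0 ;
  dist_eq0 : forall x y, d x y = 0 -> x = y ;
  dist_sym : forall x y, d x y = d y x ;
  dist_triangle : forall y x z, d x z <= d x y + d y z }.

Definition mspace (K : realType) (T : Type) (d : T -> T -> K)
  (h : is_metric d) : Type := T.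

HB.instance Definition _ (K : realType) (T : Type) (d : T -> T -> K)
  (h : is_metric d) := gen_eqMixin (mspace h).
HB.instance Definition _ (K : realType) (T : Type) (d : T -> T -> K)
  (h : is_metric d) := gen_choiceMixin (mspace h).
HB.instance Definition _ (K : realType) (T : Type) (d : T -> T -> K)
  (h : is_metric d) := isMetric.Build K (mspace h)
    (distxx h) (@dist_eq0 _ _ _ h) (dist_sym h) (dist_triangle h).

Definition ultrametric (K : realType) (X : metricType K) : Prop :=
  forall x y z : X, mdist x z <= Num.max (mdist x y) (mdist y z).

Definition spec (K : realType) (X : metricType K) : set K :=
  [set r | exists x x' : X, r = mdist x x'].

Definition R_ultrametric (K : realType) (R : set K) (X : metricType K) : Prop :=
  ultrametric X /\ spec X `<=` R.

Definition isometric_embedding (K : realType) (X Y : metricType K)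
  (f : X -> Y) : Prop := forall x x', mdist (f x) (f x') = mdist x x'.

(* The axiom of the library's [completeType], without its requirement that the
   space be pointed (hence nonempty). *)
Definition complete (K : realType) (X : metricType K) : Prop :=
  forall F : set_system X, ProperFilter F -> cauchy F ->
    exists l : X, F --> l.

Definition separable (K : realType) (X : metricType K) : Prop :=
  exists D : set X, countable D /\ dense D.

Definition polish (K : realType) (X : metricType K) : Prop :=
  complete X /\ separable X.

(* Real-valued: [sup] and [inf] are the actual bounds as soon as [A] and [B] are
   nonempty and bounded. *)
Definition hausdorff_dist (K : realType) (Z : metricType K) (A B : set Z) : K :=
  Num.max (sup [set inf [set mdist a b | b in B] | a in A])
          (sup [set inf [set mdist a b | a in A] | b in B]).

(* The carrier is a bare [Type], not a [metricType], so that its universe can be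
   smaller than that of the library's metric spaces; otherwise the collection of
   all these spaces could not itself be made a [metricType]. *)
Record compact_ultrametric (K : realType) := CompactUltrametric {
  cu_carrier : Type ;
  cu_dist : cu_carrier -> cu_carrier -> K ;
  cu_metric : is_metric cu_dist ;
  cu_ultrametric : ultrametric (mspace cu_metric) ;
  cu_compact : compact [set: mspace cu_metric] ;
  cu_nonempty : [set: mspace cu_metric] !=set0 }.

Definition cu_space (K : realType) (X : compact_ultrametric K) : metricType K :=
  mspace (cu_metric X).
Coercion cu_space : compact_ultrametric >-> Metric.type.

Definition uGH (K : realType) (X Y : compact_ultrametric K) : K :=
  inf [set r | exists (Z : metricType K) (f : X -> Z) (g : Y -> Z),
    [/\ ultrametric Z, isometric_embedding f, isometric_embedding g &
        r = hausdorff_dist (range f) (range g)]].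

Definition isometric (K : realType) (X Y : compact_ultrametric K) : Prop :=
  exists f : X -> Y, bijective f /\ isometric_embedding f.

Definition isometricb (K : realType) : rel (compact_ultrametric K) :=
  fun X Y => `[< isometric X Y >].

HB.instance Definition _ (K : realType) := gen_eqMixin (compact_ultrametric K).
HB.instance Definition _ (K : realType) :=
  gen_choiceMixin (compact_ultrametric K).

Lemma isometricb_refl (K : realType) : reflexive (@isometricb K).
Proof. by move=> X; apply/asboolP; exists id; split=> //; exists id. Qed.

Lemma isometricb_sym (K : realType) : symmetric (@isometricb K).
Proof.
move=> X Y; apply/asbool_equiv_eq.
by split=> -[f [[g fK gK] fi]]; exists g; (split; first by exists f);
   move=> x x'; rewrite -fi !gK.
Qed.

Lemma isometricb_trans (K : realType) : transitive (@isometricb K).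
Proof.
move=> Y X Z /asboolP[f [fb fi]] /asboolP[g [gb gi]]; apply/asboolP.
by exists (g \o f); split; [exact: bij_comp | move=> x x' /=; rewrite gi fi].
Qed.

Canonical isometric_equiv (K : realType) :=
  EquivRel (@isometricb K) (@isometricb_refl K) (@isometricb_sym K)
    (@isometricb_trans K).

Definition isometry_class (K : realType) : Type :=
  {eq_quot isometric_equiv K}%qT.
HB.instance Definition _ (K : realType) :=
  Choice.on (isometry_class K).
HB.instance Definition _ (K : realType) :=
  EqQuotient.on (isometry_class K).

(* [uGH] and [spec] are invariant under isometry, so the choice of
   representatives is immaterial. *)
Definition U_ (K : realType) (R : set K) : set (isometry_class K) :=
  [set c | spec (repr c : compact_ultrametric K) `<=` R].

Definition U_dist (K : realType) (R : set K) (c c' : U_ R) : K :=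
  uGH (repr (val c)) (repr (val c')).

Definition R_universal (K : realType) (R : set K) (U : metricType K) : Prop :=
  forall X : metricType K, R_ultrametric R X -> polish X ->
    exists f : X -> U, isometric_embedding f.

Definition R_ultra_homogeneous (K : realType) (R : set K) (U : metricType K) :
    Prop :=
  forall B : metricType K, R_ultrametric R B -> finite_set [set: B] ->
  forall (A : set B) (phi : A -> U),
    (forall a a' : A, mdist (phi a) (phi a') = mdist (val a) (val a')) ->
    exists psi : B -> U, isometric_embedding psi /\
      forall a : A, psi (val a) = phi a.

Definition R_Urysohn_universal (K : realType) (R : set K) (U : metricType K) :
    Prop :=
  [/\ R_ultrametric R U, polish U, R_universal R U & R_ultra_homogeneous R U].

(* Main.v *)
Require Import Defs.
From HB Require Import structures.
From mathcomp Require Import all_boot all_order all_algebra.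
From mathcomp Require Import boolp classical_sets cardinality reals topology.

Set Implicit Arguments.
Unset Strict Implicit.
Unset Printing Implicit Defensive.

Import Order.TTheory GRing.Theory Num.Theory.
Local Open Scope classical_set_scope.
Local Open Scope ring_scope.

(* Two compact ultrametric spaces are at distance [uGH X Y <= t] exactly when
   their quotients by the relation [mdist x x' <= t] are isometric; compactness
   makes the infimum attained. As the nonzero values of the spectrum of a compact
   space do not accumulate away from 0, [uGH X Y] is 0 or belongs to one of the
   spectra. Limits of Cauchy sequences are inverse limits of discretizations,
   and finite nets with distances in [R] give separability.

   Universality and ultra-homogeneity both follow from the one-point extension
   property: given finitely many spaces and prescribed distances to them, let
   [r] be the least of these, attained at [X]; the quotient of [X] at level [r],
   with every point replaced by sufficiently many points at mutual distance [r],
   is at distance at most [r] from [X], and at distance at least [r] from all the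
   given spaces, since it contains too many points that are [r] apart. The other
   distances are then forced by the strong triangle inequality. *)

(** * Truncated distances and minima over finite lists *)

Section Max.
Context {K : realType}.
Implicit Types a b t s : K.

(** The truncation [Num.max _ t] serves throughout as the distance in the quotient at level [t]:
    values above [t] are kept, all others are identified. *)
Lemma eq_maxrP a b t :
  Num.max a t = Num.max b t <-> a = b \/ a <= t /\ b <= t.
Proof.
split=> [|[->//|[/max_idPr -> /max_idPr ->//]]].
case: (leP a t) => at_; case: (leP b t) => bt; last by left.
- by right.
- by move=> E; rewrite E ltxx in bt.
- by move=> E; rewrite E ltxx in at_.
Qed.

Lemma le_eq_maxr a b t s : t <= s ->
  Num.max a t = Num.max b t -> Num.max a s = Num.max b s.
Proof.
move=> ts /eq_maxrP[->//|[at_ bt]]; apply/eq_maxrP; right.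
by split; apply: le_trans ts.
Qed.

Lemma le_inf_gt a t : (forall s, t < s -> a <= s) -> a <= t.
Proof. by move=> h; apply/ler_addgt0Pr => e e0; apply: h; rewrite ltrDl. Qed.

Lemma eq_maxr_inf_gt a b t :
  (forall s, t < s -> Num.max a s = Num.max b s) ->
  Num.max a t = Num.max b t.
Proof.
suff le c d : (forall s, t < s -> Num.max c s = Num.max d s) ->
    Num.max c t <= Num.max d t.
  by move=> h; apply/le_anti; rewrite !le// => s /h.
move=> h; rewrite ge_max [t <= _]le_max lexx orbT andbT.
apply: le_inf_gt => s; rewrite gt_max => /andP[ds ts].
by rewrite -(max_idPr (ltW ds)) -h// le_max lexx.
Qed.

End Max.

Lemma seq_argmin (K : realType) (T : eqType) (f : T -> K) (x : T) (s : seq T) :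
  exists2 a, a \in x :: s & forall y, y \in x :: s -> f a <= f y.
Proof.
elim: s x => [x|y s IH x].
  by exists x => [|y]; rewrite inE// => /eqP ->.
have [a ays amin] := IH y; have [xa|/ltW ax] := leP (f x) (f a).
  exists x => [|z]; first exact: mem_head.
  rewrite inE => /predU1P[->//|/amin]; exact: le_trans.
exists a => [|z]; first by rewrite inE ays orbT.
by rewrite inE => /predU1P[->//|/amin].
Qed.

(** * Consequences of the strong triangle inequality *)

Section Ultrametric.
Context {K : realType}.

Lemma eq_mdist_inf (X Y : metricType K) (x x' : X) (y y' : Y) :
  (forall t, 0 < t -> Num.max (mdist x x') t = Num.max (mdist y y') t) ->
  mdist x x' = mdist y y'.
Proof. by move/eq_maxr_inf_gt; rewrite !(max_idPl (mdist_ge0 _ _)). Qed.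

Section Space.
Context (X : metricType K) (uX : ultrametric X).
Implicit Types (x y z : X) (t : K).

Lemma ultra_le y x z t : mdist x y <= t -> mdist y z <= t -> mdist x z <= t.
Proof.
by move=> xy yz; apply: le_trans (uX x y z) _; rewrite ge_max xy.
Qed.

Lemma ultra_lt y x z t : mdist x y < t -> mdist y z < t -> mdist x z < t.
Proof.
by move=> xy yz; apply: le_lt_trans (uX x y z) _; rewrite gt_max xy.
Qed.

(** Moving the endpoints by at most [t] cannot affect a distance above [t], since such triangles are
    isosceles. Hence the quotient distance at level [t] is well defined. *)
Lemma ultra_maxr x x' y y' t : mdist x y <= t -> mdist x' y' <= t ->
  Num.max (mdist x x') t = Num.max (mdist y y') t.
Proof.
suff le (a a' b b' : X) : mdist a b <= t -> mdist a' b' <= t ->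
    Num.max (mdist a a') t <= Num.max (mdist b b') t.
  by move=> xy xy'; apply/le_anti; rewrite !le// metric_sym.
move=> ab ab'; rewrite ge_max [t <= _]le_max lexx orbT andbT.
apply: (ultra_le (y := b)); first by rewrite le_max ab orbT.
apply: (ultra_le (y := b')); first by rewrite le_max lexx.
by rewrite metric_sym le_max ab' orbT.
Qed.

End Space.

Lemma is_metric_ultra (T : Type) (d : T -> T -> K) :
    (forall x y, 0 <= d x y) -> (forall x, d x x = 0) ->
    (forall x y, d x y = 0 -> x = y) -> (forall x y, d x y = d y x) ->
    (forall x y z, d x z <= Num.max (d x y) (d y z)) ->
  is_metric d.
Proof.
move=> d_ge0 dxx d_eq0 d_sym d_ultra; split=> // y x z.
by apply: le_trans (d_ultra x y z) _; rewrite ge_max lerDl lerDr !d_ge0.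
Qed.

End Ultrametric.

(** * Finite nets, ultrafilter limits and gaps in the spectrum of a compact space *)

Section Compact.
Context {K : realType} (X : metricType K) (cX : compact [set: X]).

Lemma compact_net (t : K) : 0 < t ->
  exists s : seq X, forall x, exists2 y, y \in s & mdist x y < t.
Proof.
move=> t0; apply: contrapT => nonet.
(* The filter generated by the complements of finite unions of open [t]-balls, proper when there is
   no finite net. A cluster point [x] contradicts the complement of its own ball. *)
pose F := [set A : set X |
  exists s : seq X, forall x, (forall y, y \in s -> t <= mdist x y) -> A x].
have FF : ProperFilter F.
  split; first by move=> [s hs]; apply: nonet; exists s => x;
    apply: contrapT => nx; apply: (hs x) => y ys; rewrite leNgt;
    apply/negP => xy; apply: nx; exists y.
  split; first by exists [::].
    move=> A B [s hs] [s' hs']; exists (s ++ s') => x hx.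
    split; [apply: hs | apply: hs'] => y ys; apply: hx;
    by rewrite mem_cat ys ?orbT.
  by move=> A B AB [s hs]; exists s => x /hs/AB.
have [x [_ clx]] := cX FF filterT.
have [|y [/= yx]] := clx [set y | t <= mdist y x] (ball x t) _
    (nbhsx_ballx _ _ t0).
  by exists [:: x] => y /(_ x (mem_head _ _)).
by rewrite ballEmdist /= metric_sym ltNge yx.
Qed.

(** A cluster point of the image of [G] is already a limit: [G] contains the preimage of each ball
    about it or the complement, and the complement is excluded by clustering. *)
Lemma compact_ultra_lim (T : Type) (G : set_system T) (f : T -> X) :
  UltraFilter G -> exists x, forall e, 0 < e -> G [set t | mdist (f t) x < e].
Proof.
move=> UG; have [x [_ clx]] := cX (F := f @ G) _ filterT.
exists x => e e0; have [//|GC] := in_ultra_setVsetC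
  [set t | mdist (f t) x < e] UG.
have [|y [/= yx]] := clx [set y | e <= mdist y x] (ball x e) _
    (nbhsx_ballx _ _ e0).
  change (G [set t | e <= mdist (f t) x]); apply: filterS GC => t /= /negP.
  by rewrite -leNgt.
by rewrite ballEmdist /= metric_sym ltNge yx.
Qed.

Lemma compact_bounded : exists M : K, forall x x' : X, mdist x x' <= M.
Proof.
have [s hs] := compact_net (@ltr01 K).
have [M hM] : exists M, forall y y', y \in s -> y' \in s -> mdist y y' <= M.
  exists (\big[Num.max/0]_(y <- s) \big[Num.max/0]_(y' <- s) mdist y y').
  move=> y y' ys ys'; apply: (bigmax_sup_seq _ _ _ _ _ ys isT).
  by apply: (bigmax_sup_seq _ _ _ _ _ ys' isT).
exists (1 + M + 1) => x x'.
have [y ys xy] := hs x; have [y' ys' xy'] := hs x'.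
apply: le_trans (metric_triangle _ y' _) _; apply: lerD; last first.
  by rewrite metric_sym ltW.
by apply: le_trans (metric_triangle _ y _) _; rewrite lerD ?hM// ltW.
Qed.

(** By [ultra_maxr], a distance is at most [u / 2] or equals a distance between two points of a
    finite [u / 2]-net, so only finitely many values lie between [u / 2] and [u]. *)
Lemma compact_spec_gap (uX : ultrametric X) (u : K) : 0 < u ->
  exists2 t, 0 <= t < u & forall x x' : X, mdist x x' < u -> mdist x x' <= t.
Proof.
move=> u0; have u20 : 0 < u / 2 by rewrite divr_gt0.
have [s hs] := compact_net u20.
pose m := \big[Num.max/(u/2)]_(y <- s)
  \big[Num.max/(u/2)]_(y' <- s | mdist y y' < u) mdist y y'.
exists m.
  have um : u / 2 <= m by apply: bigmax_ge_id.
  rewrite (le_trans (ltW u20) um) /=.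
  have u2u : u / 2 < u by rewrite ltr_pdivrMr// mulr_natr mulr2n ltrDl.
  by apply: bigmax_lt => // y _; apply: bigmax_lt.
move=> x x' xx'; have [y ys xy] := hs x; have [y' ys' xy'] := hs x'.
have /eq_maxrP[E|[h _]] := ultra_maxr uX (ltW xy) (ltW xy').
  rewrite E in xx' *.
  apply: (bigmax_sup_seq _ _ _ _ _ ys isT).
  by apply: (bigmax_sup_seq _ _ _ _ _ ys' xx').
exact: le_trans h (bigmax_ge_id _ _ _ _).
Qed.

End Compact.

(** * Coarse isometries and the Gromov-Hausdorff ultrametric *)

Section CoarseIsometry.
Context {K : realType}.
Implicit Types (X Y Z : metricType K) (t : K).

(* [f] induces an isometry between the quotients of [X] and [Y] by the
   equivalence relations [mdist x x' <= t]. *)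
Definition coarse_iso t X Y (f : X -> Y) : Prop :=
  (forall x x', Num.max (mdist (f x) (f x')) t = Num.max (mdist x x') t) /\
  forall y, exists x, mdist (f x) y <= t.

Definition coarsely_iso t X Y : Prop := exists f, @coarse_iso t X Y f.

Lemma coarse_iso_le t X Y (f : X -> Y) x x' : coarse_iso t f ->
  (mdist (f x) (f x') <= t) = (mdist x x' <= t).
Proof.
move=> [/(_ x x') E _].
by have := congr1 (fun a => a <= t) E; rewrite !ge_max lexx !andbT.
Qed.

Lemma coarsely_iso_refl t X : 0 <= t -> coarsely_iso t X X.
Proof. by move=> t0; exists id; split=> // y; exists y; rewrite mdistxx. Qed.

Lemma coarsely_iso_sym t X Y : ultrametric Y ->
  coarsely_iso t X Y -> coarsely_iso t Y X.
Proof.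
move=> uY [f [fE fs]]; have [g gP] := choice fs; exists g; split=> [y y'|x].
  by rewrite -fE; apply: ultra_maxr.
by exists (f x); rewrite -(coarse_iso_le _ _ (conj fE fs)).
Qed.

Lemma coarsely_iso_trans t Y X Z : ultrametric Z ->
  coarsely_iso t X Y -> coarsely_iso t Y Z -> coarsely_iso t X Z.
Proof.
move=> uZ [f [fE fs]] [g [gE gs]]; exists (g \o f); split=> [x x'|z] /=.
  by rewrite gE fE.
have [y yz] := gs z; have [x xy] := fs y; exists x.
by apply: (ultra_le uZ _ yz); rewrite (coarse_iso_le _ _ (conj gE gs)).
Qed.

Lemma coarsely_iso_mono t s X Y : t <= s ->
  coarsely_iso t X Y -> coarsely_iso s X Y.
Proof.
move=> ts [f [fE fs]]; exists f; split=> [x x'|y]; first exact: le_eq_maxr ts _.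
by have [x xy] := fs y; exists x; apply: le_trans ts.
Qed.

(* The maps at levels [t + 1/(n+1)] converge pointwise along an ultrafilter. *)
Lemma coarsely_iso_inf t X Y : 0 <= t -> ultrametric Y ->
    compact [set: X] -> compact [set: Y] ->
  (forall s, t < s -> coarsely_iso s X Y) -> coarsely_iso t X Y.
Proof.
move=> t0 uY cX cY h.
have /choice[F FP] : forall n, exists f, @coarse_iso (t + n.+1%:R^-1) X Y f.
  by move=> n; apply: h; rewrite ltrDl invr_gt0.
have [G [UG ooG]] := @ultraFilterLemma _ \oo _.
have /choice[f fP] : forall x, exists y,
    forall e, 0 < e -> G [set n | mdist (F n x) y < e].
  by move=> x; exact: compact_ultra_lim.
have Gs s : t < s -> G [set n | t + n.+1%:R^-1 <= s].
  move=> /ltr_add_invr[k ks]; apply: ooG; exists k => // n /= kn.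
  apply: le_trans (ltW ks); rewrite lerD2l lef_pV2 ?posrE//.
  by rewrite ler_nat.
exists f; split=> [x x'|y].
  apply: eq_maxr_inf_gt => s ts; have s0 := le_lt_trans t0 ts.
  have [n [[/= ns nx] nx']] := filter_ex
    (filterI (filterI (Gs _ ts) (fP x _ s0)) (fP x' _ s0)).
  rewrite -(le_eq_maxr ns ((FP n).1 x x')); apply: ultra_maxr => //.
    by rewrite metric_sym ltW.
  by rewrite metric_sym ltW.
(* Surjectivity up to [t]: the approximate preimages of [y] under the maps [F n] converge along the
   same ultrafilter. *)
have /choice[u uP] : forall n, exists x, mdist (F n x) y <= t + n.+1%:R^-1.
  by move=> n; have [_ /(_ y)] := FP n.
have [x xP] := compact_ultra_lim cX u UG; exists x.
apply: le_inf_gt => s ts; have s0 := le_lt_trans t0 ts.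
have [n [[/= ns nx] ux]] := filter_ex
  (filterI (filterI (Gs _ ts) (fP x _ s0)) (xP _ s0)).
apply: (ultra_le uY (y := F n x)); first by rewrite metric_sym ltW.
apply: (ultra_le uY (y := F n (u n))); last exact: le_trans (uP n) ns.
have /eq_maxrP[->|[]//] := le_eq_maxr ns ((FP n).1 x (u n)).
by rewrite metric_sym ltW.
Qed.

End CoarseIsometry.

(** * Bounds on the Hausdorff distance *)

Section Hausdorff.
Context {K : realType} (Z : metricType K).
Implicit Types (A B : set Z) (t : K).

Lemma hausdorff_dist_le A B t : A !=set0 -> B !=set0 ->
    (forall a, A a -> exists2 b, B b & mdist a b <= t) ->
    (forall b, B b -> exists2 a, A a & mdist a b <= t) ->
  hausdorff_dist A B <= t.
Proof.
move=> A0 B0 AB BA; rewrite /hausdorff_dist ge_max; apply/andP; split.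
  apply: ge_sup => [|_ [a Aa <-]]; first exact: image_nonempty.
  have [b Bb abt] := AB a Aa; apply: le_trans abt.
  by apply: ge_inf; [exists 0 => _ [? _ <-]; exact: mdist_ge0 | exists b].
apply: ge_sup => [|_ [b Bb <-]]; first exact: image_nonempty.
have [a Aa abt] := BA b Bb; apply: le_trans abt.
by apply: ge_inf; [exists 0 => _ [? _ <-]; exact: mdist_ge0 | exists a].
Qed.

(** The bound [M] ensures that the real-valued [sup] really dominates each of the infima. *)
Lemma hausdorff_dist_lt A B t M : B !=set0 ->
    (forall a b, A a -> B b -> mdist a b <= M) -> hausdorff_dist A B < t ->
  forall a, A a -> exists2 b, B b & mdist a b < t.
Proof.
move=> [b0 Bb0] ABM; rewrite /hausdorff_dist gt_max => /andP[supt _] a Aa.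
have inft : inf [set mdist a b | b in B] < t.
  apply: le_lt_trans supt; apply: ub_le_sup; last by exists a.
  exists M => _ [a' Aa' <-]; apply: le_trans (ABM a' b0 Aa' Bb0).
  by apply: ge_inf; [exists 0 => _ [? _ <-]; exact: mdist_ge0 | exists b0].
have [|_ [b Bb <-] abt] := inf_lt _ inft; last by exists b.
by apply: image_nonempty; exists b0.
Qed.

Lemma hausdorff_distC A B : hausdorff_dist A B = hausdorff_dist B A.
Proof.
rewrite /hausdorff_dist maxC; congr (Num.max (sup _) (sup _));
by apply: eq_imagel => x _; congr inf; apply: eq_imagel => y _;
  exact: metric_sym.
Qed.

End Hausdorff.

(** * Gluing two spaces along a coarse isometry *)

Section Gluing.
Context {K : realType} (X Y : compact_ultrametric K) (t : K) (t0 : 0 < t).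
Variables (f : X -> Y) (fP : coarse_iso t f).

(** The lower bound [t] on cross distances keeps the two copies disjoint, and puts [x] and [f x]
    exactly [t] apart. *)
Definition glue_dist (p q : X + Y) : K :=
  match p, q with
  | inl x, inl x' => mdist x x'
  | inr y, inr y' => mdist y y'
  | inl x, inr y | inr y, inl x => Num.max (mdist (f x) y) t
  end.

Lemma glue_dist_ultra p q r :
  glue_dist p r <= Num.max (glue_dist p q) (glue_dist q r).
Proof.
have uX := @cu_ultrametric _ X; have uY := @cu_ultrametric _ Y.
suff le m : glue_dist p q <= m -> glue_dist q r <= m -> glue_dist p r <= m.
  by apply: le; rewrite le_max lexx ?orbT.
(* A triangle meeting both copies has a crossing side among the two bounded by [m], which forces
   [t <= m]; from there on [f] respects the relation of being at distance at most [m]. *)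
have f_le : t <= m ->
    forall x x', (mdist (f x) (f x') <= m) = (mdist x x' <= m).
  move=> tm x x'; have := congr1 (fun a => a <= m) (le_eq_maxr tm (fP.1 x x')).
  by rewrite !ge_max lexx !andbT.
case: p q r => [x|y] [x'|y'] [x''|y''] /=; rewrite ?ge_max.
- exact: (ultra_le uX).
- move=> xx' /andP[x'y tm]; rewrite tm andbT.
  by apply: (ultra_le uY _ x'y); rewrite f_le.
- move=> /andP[xy tm] /andP[x''y _]; rewrite -f_le//.
  by apply: (ultra_le uY xy); rewrite metric_sym.
- by move=> /andP[xy' tm] y'y''; rewrite tm andbT; apply: (ultra_le uY xy').
- move=> /andP[x'y tm] x'x''; rewrite tm andbT.
  by apply: (ultra_le uY _ x'y); rewrite f_le// metric_sym.
- move=> /andP[x'y tm] /andP[x'y'' _].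
  by apply: (ultra_le uY _ x'y''); rewrite metric_sym.
- move=> yy' /andP[x''y' tm]; rewrite tm andbT.
  by apply: (ultra_le uY x''y'); rewrite metric_sym.
- exact: (ultra_le uY).
Qed.

Lemma glue_dist_is_metric : is_metric glue_dist.
Proof.
apply: is_metric_ultra glue_dist_ultra => [[x|y] [x'|y']|[x|y]|[x|y] [x'|y']|
  [x|y] [x'|y']] /=; rewrite ?mdist_ge0 ?mdistxx ?le_max ?(ltW t0) ?orbT//.
- by move=> /mdist_positivity ->.
- by move=> E; move: t0; rewrite -E gt_max ltxx andbF.
- by move=> E; move: t0; rewrite -E gt_max ltxx andbF.
- by move=> /mdist_positivity ->.
- exact: metric_sym.
- exact: metric_sym.
Qed.

End Gluing.

(** * The Gromov-Hausdorff ultrametric through coarse isometries *)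

Section GromovHausdorff.
Context {K : realType}.
Implicit Types (X Y Z : compact_ultrametric K) (t : K).

(** Send each point of [X] to a point of [Y] less than [t] away in [Z]; by [ultra_maxr] in [Z] this
    preserves distances above [t]. *)
Lemma hausdorff_embedding_coarse X Y (Z : metricType K) (f : X -> Z)
    (g : Y -> Z) t :
    ultrametric Z -> isometric_embedding f -> isometric_embedding g ->
    hausdorff_dist (range f) (range g) < t ->
  0 < t /\ coarsely_iso t X Y.
Proof.
move=> uZ fi gi fgt.
have [MX hX] := compact_bounded (@cu_compact _ X).
have [MY hY] := compact_bounded (@cu_compact _ Y).
have [x0 _] := cu_nonempty X; have [y0 _] := cu_nonempty Y.
have fg_bounded x y : mdist (f x) (g y) <= MX + (mdist (f x0) (g y0) + MY).
  apply: le_trans (metric_triangle _ (f x0) _) _; rewrite lerD ?fi ?hX//.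
  by apply: le_trans (metric_triangle _ (g y0) _) _; rewrite lerD ?gi ?hY.
have fg x : exists y, mdist (f x) (g y) < t.
  have g0 : range g !=set0 by exists (g y0); exists y0.
  have fgM a b : range f a -> range g b ->
      mdist a b <= MX + (mdist (f x0) (g y0) + MY).
    by move=> [x' _ <-] [y' _ <-].
  have [_ [y _ <-]] := hausdorff_dist_lt g0 fgM fgt (imageT f x).
  by exists y.
have gf y : exists x, mdist (f x) (g y) < t.
  rewrite hausdorff_distC in fgt.
  have f0 : range f !=set0 by exists (f x0); exists x0.
  have gfM a b : range g a -> range f b ->
      mdist a b <= MX + (mdist (f x0) (g y0) + MY).
    by move=> [y' _ <-] [x' _ <-]; rewrite metric_sym.
  have [_ [x _ <-]] := hausdorff_dist_lt f0 gfM fgt (imageT g y).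
  by exists x; rewrite metric_sym.
split; first by have [y] := fg x0; apply: le_lt_trans (mdist_ge0 _ _).
have [h hP] := choice fg; exists h; split=> [x x'|y].
  by rewrite -gi -fi; apply: ultra_maxr; rewrite // metric_sym ltW.
have [x xy] := gf y; exists x; rewrite -gi.
by apply: (ultra_le uZ (y := f x)); rewrite ltW// metric_sym.
Qed.

Let uGH_set X Y := [set r : K |
  exists (Z : metricType K) (f : X -> Z) (g : Y -> Z),
    [/\ ultrametric Z, isometric_embedding f, isometric_embedding g &
        r = hausdorff_dist (range f) (range g)]].

Let uGH_set_ge0 X Y : lbound (uGH_set X Y) 0.
Proof.
move=> _ [Z [f [g [uZ fi gi ->]]]]; rewrite leNgt; apply/negP.
by move=> /(hausdorff_embedding_coarse uZ fi gi)[]; rewrite ltxx.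
Qed.

Let coarse_uGH_set X Y t : 0 < t -> coarsely_iso t X Y ->
  exists2 r, uGH_set X Y r & r <= t.
Proof.
move=> t0 [f fP]; have h := glue_dist_is_metric t0 fP.
pose i (x : X) : mspace h := inl x; pose j (y : Y) : mspace h := inr y.
have [x0 _] := cu_nonempty X; have [y0 _] := cu_nonempty Y.
exists (hausdorff_dist (range i) (range j)).
  by exists (mspace h), i, j; split=> //; exact: glue_dist_ultra fP.
apply: hausdorff_dist_le => [||_ [x _ <-]|_ [y _ <-]].
- by exists (i x0); exists x0.
- by exists (j y0); exists y0.
- exists (j (f x)); first by exists (f x).
  by rewrite /mdist /= ge_max mdistxx ltW //=.
- have [x xy] := fP.2 y; exists (i x); first by exists x.
  by rewrite /mdist /= ge_max xy /=.
Qed.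

Let uGH_set_neq0 X Y : uGH_set X Y !=set0.
Proof.
have [MX hX] := compact_bounded (@cu_compact _ X).
have [MY hY] := compact_bounded (@cu_compact _ Y).
have [y0 _] := cu_nonempty Y; have [x0 _] := cu_nonempty X.
(* A level above both diameters, where both spaces collapse to a point and a constant map is a
   coarse isometry; the 1 makes it positive. *)
pose M := Num.max 1 (Num.max MX MY).
have [||r rP _] := @coarse_uGH_set X Y M.
- by rewrite lt_max ltr01.
- exists (fun=> y0); split=> [x x'|y].
    apply/eq_maxrP; right; rewrite mdistxx !le_max ler01 hX !orbT.
    by split.
  by exists x0; rewrite !le_max hY !orbT.
- by exists r.
Qed.

Lemma uGH_ge0 X Y : 0 <= uGH X Y.
Proof. by apply: lb_le_inf (@uGH_set_ge0 X Y); exact: uGH_set_neq0. Qed.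

(** Both directions pass through all levels [s > t]: one because an infimum is only approached, with
    [coarsely_iso_inf] giving the limit, the other because gluing needs a positive level while [t]
    may be 0. *)
Lemma uGH_leP X Y t : 0 <= t -> uGH X Y <= t <-> coarsely_iso t X Y.
Proof.
move=> t0; split=> [le_t|XY].
  apply: (coarsely_iso_inf t0 (@cu_ultrametric _ Y) (@cu_compact _ X)
    (@cu_compact _ Y)) => s ts.
  have [|r [Z [f [g [uZ fi gi ->]]]]] := inf_lt _ (le_lt_trans le_t ts).
    exact: uGH_set_neq0.
  by move=> /(hausdorff_embedding_coarse uZ fi gi)[].
apply: le_inf_gt => s ts.
have [|r rP rs] := coarse_uGH_set (le_lt_trans t0 ts) (Y := Y) (X := X).
  exact: coarsely_iso_mono (ltW ts) XY.
by apply: le_trans rs; apply: ge_inf => //; exists 0; exact: uGH_set_ge0.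
Qed.

Lemma uGHxx X : uGH X X = 0.
Proof.
apply/le_anti; rewrite uGH_ge0 andbT; apply/uGH_leP => //.
exact: coarsely_iso_refl.
Qed.

Lemma uGHC X Y : uGH X Y = uGH Y X.
Proof.
suff le X' Y' : uGH X' Y' <= uGH Y' X' by apply/le_anti; rewrite !le.
apply/uGH_leP; first exact: uGH_ge0.
apply: coarsely_iso_sym; first exact: cu_ultrametric.
by apply/uGH_leP; rewrite ?uGH_ge0.
Qed.

Lemma uGH_ultra X Y Z : uGH X Z <= Num.max (uGH X Y) (uGH Y Z).
Proof.
have m0 : 0 <= Num.max (uGH X Y) (uGH Y Z) by rewrite le_max uGH_ge0.
apply/uGH_leP => //; apply: (coarsely_iso_trans (@cu_ultrametric _ Z) (Y := Y)).
  by apply/uGH_leP; rewrite // le_max lexx.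
by apply/uGH_leP; rewrite // le_max lexx orbT.
Qed.

Lemma uGH_eq0 X Y : uGH X Y = 0 -> isometric X Y.
Proof.
move=> /eqP; rewrite eq_le => /andP[/uGH_leP-/(_ (lexx _))[f [fE fs]] _].
have fi : isometric_embedding f.
  by move=> x x'; have := fE x x'; rewrite !(max_idPl (mdist_ge0 _ _)).
have [g gP] := choice fs.
have gK : cancel g f.
  by move=> y; apply: mdist_positivity; apply/le_anti; rewrite gP mdist_ge0.
exists f; split=> //; exists g => // x.
by apply: mdist_positivity; rewrite -fi gK mdistxx.
Qed.

(** If [u] were in neither spectrum, the gaps below [u] would give some [t < u] for which being at
    most [t] and being at most [u] agree on all distances. A coarse isometry at level [u] would then
    be one at level [t]. *)
Lemma uGH_spec X Y : 0 < uGH X Y ->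
  spec X (uGH X Y) \/ spec Y (uGH X Y).
Proof.
move=> u0; set u := uGH X Y; apply: contrapT => /not_orP[nX nY].
have [tX /andP[tX0 tXu] hX] :=
  compact_spec_gap (@cu_compact _ X) (@cu_ultrametric _ X) u0.
have [tY /andP[tY0 tYu] hY] :=
  compact_spec_gap (@cu_compact _ Y) (@cu_ultrametric _ Y) u0.
pose t := Num.max tX tY; have tu : t < u by rewrite gt_max tXu.
have leX x x' : (mdist (x : X) x' <= t) = (mdist x x' <= u).
  apply/idP/idP => [/le_trans|xu]; first by apply; exact: ltW.
  rewrite le_max hX// lt_neqAle xu andbT.
  by apply/negP => /eqP E; apply: nX; exists x, x'.
have leY y y' : (mdist (y : Y) y' <= t) = (mdist y y' <= u).
  apply/idP/idP => [/le_trans|yu]; first by apply; exact: ltW.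
  rewrite le_max hY ?orbT// lt_neqAle yu andbT.
  by apply/negP => /eqP E; apply: nY; exists y, y'.
suff: uGH X Y <= t by rewrite leNgt tu.
have /uGH_leP-/(_ (ltW u0))[f [fE fs]] : uGH X Y <= u by [].
apply/uGH_leP; first by rewrite le_max tX0.
exists f; split=> [x x'|y]; last by have [x xy] := fs y; exists x; rewrite leY.
by apply/eq_maxrP; rewrite leX leY; apply/eq_maxrP.
Qed.

End GromovHausdorff.

(** * Constructions of compact ultrametric spaces *)

Section SeparatedNet.
Context {K : realType}.
Implicit Type t : K.

(** [rho] chooses one representative in each closed [t]-ball, so its fixed points model the quotient
    at level [t]. The choice depends only on the ball as a set, and equivalent points have the same
    ball. *)
Lemma separated_net (X : metricType K) t : ultrametric X -> 0 <= t ->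
  exists rho : X -> X, (forall x, mdist x (rho x) <= t) /\
    (forall x x', mdist x x' <= t -> rho x = rho x').
Proof.
move=> uX t0; have [[x0]|noX] := pselect (inhabited X); last first.
  by exists id; split=> x; case: noX; exists.
exists (fun x => xget x0 [set y | mdist x y <= t]); split=> [x|x x' xx'].
  apply: (@xgetPex _ x0 [set y | mdist x y <= t]); exists x.
  by rewrite /= mdistxx.
congr xget; apply/seteqP; split=> y /= xy; last exact: (ultra_le uX xx').
by apply: (ultra_le uX _ xy); rewrite metric_sym.
Qed.

(** Points at least [t] apart have distinct neighbours in a net of radius [t], so the size of the
    net bounds their number. *)
Lemma packing_bound (X : metricType K) t :
    ultrametric X -> compact [set: X] -> 0 < t ->
  exists N : nat, forall n (e : 'I_n -> X),
    (forall i j, i != j -> t <= mdist (e i) (e j)) -> (n <= N)%N.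
Proof.
move=> uX cX t0; have [s hs] := compact_net cX t0.
have /choice[g gP] : forall x, exists y, y \in s /\ mdist x y < t.
  by move=> x; have [y] := hs x; exists y.
exists (size s) => n e sep.
have ge_inj : injective (g \o e).
  move=> i j /= gij; apply/eqP; apply/negPn/negP => /sep; rewrite leNgt.
  case/negP; apply: (ultra_lt uX (y := g (e i))); first exact: (gP _).2.
  by rewrite gij metric_sym; exact: (gP _).2.
rewrite -[n]card_ord -(size_image (g \o e)); apply: uniq_leq_size.
  by rewrite map_inj_uniq ?enum_uniq.
by move=> _ /mapP[i _ ->]; exact: (gP _).1.
Qed.

(* The quotient of [X] at level [t] with every point replaced by [N.+1] points
   at distance [t] from each other. *)
Lemma branching_space (X : compact_ultrametric K) t (N : nat) : 0 < t ->
  exists Y : compact_ultrametric K,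
    [/\ coarsely_iso t Y X, spec Y `<=` spec X `|` [set 0; t] &
        exists e : 'I_N.+1 -> Y, forall i j, i != j -> mdist (e i) (e j) = t].
Proof.
move=> t0; have uX := @cu_ultrametric _ X.
have [rho [rho_le rho_eq]] := separated_net uX (ltW t0).
(* [nat] rather than ['I_N.+1], whose universe exceeds that of [cu_carrier]. *)
pose T := {p : cu_carrier X * nat | rho p.1 = p.1 /\ (p.2 < N.+1)%N}.
pose fst (p : T) : X := (sval p).1.
have T_eq (p q : T) : fst p = fst q -> (sval p).2 = (sval q).2 -> p = q.
  case: p q => [[x i] hx] [[y j] hy]; rewrite /fst /= => xy ij.
  by apply: eq_exist; rewrite xy ij.
(* Copies of one representative are [t] apart; other distances are those of the representatives,
   which already exceed [t]. *)
pose d (p q : T) :=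
  if `[< p = q >] then 0 else Num.max (mdist (fst p) (fst q)) t.
have dxx p : d p p = 0 by rewrite /d; case: asboolP.
have d_max p q : Num.max (d p q) t = Num.max (mdist (fst p) (fst q)) t.
  rewrite /d; case: asboolP => [->|_]; first by rewrite mdistxx.
  by rewrite -maxA maxxx.
have d_ultra p q r : d p r <= Num.max (d p q) (d q r).
  have d_ge0 p' q' : 0 <= d p' q'.
    by rewrite /d; case: asboolP => // _; rewrite le_max mdist_ge0.
  have [->|pq] := pselect (p = q); first by rewrite le_max lexx orbT.
  have [->|qr] := pselect (q = r); first by rewrite le_max lexx.
  rewrite {2 3}/d; case: asboolP => // _; case: asboolP => // _.
  rewrite {1}/d; case: asboolP => _; first by rewrite !le_max mdist_ge0.
  rewrite maxACA maxxx ge_max [t <= _]le_max lexx orbT andbT.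
  by rewrite le_max uX.
have hd : is_metric d.
  apply: is_metric_ultra => // p q.
  - by rewrite /d; case: asboolP => // _; rewrite le_max mdist_ge0.
  - rewrite /d; case: asboolP => // _ E.
    by move: t0; rewrite -E gt_max ltxx andbF.
  - rewrite /d metric_sym; case: asboolP => [->|pq]; case: asboolP => // qp.
    by case: pq.
(* An ultrafilter concentrates on a single point: the limit of the first coordinates fixes the
   representative, and one of the finitely many indices must then belong to a set of [G]. *)
have cT : compact [set: mspace hd].
  rewrite compact_ultra => G UG _.
  have [x xP] := compact_ultra_lim (@cu_compact _ X) fst UG.
  have Gx : G [set p | fst p = rho x].
    apply: filterS (xP t t0) => p /= /ltW/rho_eq <-; exact/esym/(svalP p).1.
  have [k Gk] : exists k : 'I_N.+1, G [set p | inord (sval p).2 = k].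
    apply: contrapT => /forallNP nG.
    have Gn (k : 'I_N.+1) : G [set p : T | inord (sval p).2 <> k].
      have [Gk|//] := in_ultra_setVsetC [set p : T | inord (sval p).2 = k] UG.
      by case: (nG k).
    have [p] := filter_ex (filter_forall (F := G) _ Gn).
    by move=> /(_ (inord (sval p).2)).
  have [p0 [/= p0x p0k]] := filter_ex (filterI Gx Gk).
  exists p0; split=> //; apply/metricType_numDomainType.fcvgrPdist_lt => e e0.
  apply: filterS (filterI Gx Gk) => p [/= px pk].
  suff -> : p = p0 by rewrite mdistxx.
  apply: T_eq; first by rewrite px.
  by rewrite -(inordK (svalP p).2) -(inordK (svalP p0).2) pk p0k.
have [x0 _] := cu_nonempty X.
have rhorho x : rho (rho x) = rho x by apply/esym/rho_eq.
pose pt x (i : 'I_N.+1) : T :=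
  exist _ (rho x, val i) (conj (rhorho x) (ltn_ord i)).
exists (CompactUltrametric (d_ultra : ultrametric (mspace hd)) cT
  (ex_intro _ (pt x0 ord0) I)); split.
- exists fst; split=> [p q|x]; first by rewrite -d_max.
  by exists (pt x ord0); rewrite metric_sym; exact: rho_le.
- move=> _ [p [q ->]]; rewrite /mdist /= /d; case: asboolP => _.
    by right; left.
  rewrite /Num.max; case: ifP => _; first by right; right.
  by left; exists (fst p), (fst q).
- exists (pt x0) => i j ij; rewrite /mdist /= /d; case: asboolP => [[E]|_].
    by move/val_inj: E ij => ->; rewrite eqxx.
  by rewrite /fst /= mdistxx (max_idPr (ltW t0)).
Qed.

End SeparatedNet.

(** * Inverse limits of discretizations *)

Section InverseLimit.
Context {K : realType}.

(** Above level [n] the thread comes from successive choices of preimages in [A], below it from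
    applying [f]; the induction shifts the system by one level. *)
Lemma thread_through (X : nat -> Type) (A : forall n, X n -> Prop)
    (f : forall n, X n.+1 -> X n) n (y : X n) :
    (forall n x, A n.+1 x -> A n (f n x)) ->
    (forall n y, A n y -> exists x, A n.+1 x /\ f n x = y) ->
    A n y ->
  exists a : forall k, X k,
    (forall k, A k (a k) /\ f k (a k.+1) = a k) /\ a n = y.
Proof.
elim: n => [|n IH] in X A f y * => fA fs Ay.
  have step k (x : {x : X k | A k x}) :
      {z : {z : X k.+1 | A k.+1 z} | f k (sval z) = sval x}.
    case: x => x Ax; have /cid[z [Az zx]] := fs k x Ax.
    by exists (exist _ z Az).
  pose b := nat_rect (fun k => {x : X k | A k x}) (exist _ y Ay)
    (fun k x => sval (step k x)).
  exists (fun k => sval (b k)); split=> // k; split; first exact: svalP.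
  exact: (svalP (step k (b k))).
have [|||a [aP any]] := IH (X \o S) (fun k => A k.+1) (fun k => f k.+1) y.
- by move=> k; exact: fA.
- by move=> k; exact: fs.
- exact: Ay.
exists (fun k => match k with 0 => f 0%N (a 0%N) | k'.+1 => a k' end).
split=> // -[|k]; last exact: aP.
by split=> //; apply: fA; exact: (aP 0%N).1.
Qed.

Variables (X : nat -> compact_ultrametric K) (t : nat -> K).
Hypothesis t_gt0 : forall n, 0 < t n.
Hypothesis t_noninc : forall m n, (m <= n)%N -> t n <= t m.
Hypothesis t_to0 : forall e, 0 < e -> exists n, t n < e.
Hypothesis X_cauchy : forall n, coarsely_iso (t n) (X n.+1) (X n).

(** The points of [L] are threads of representatives, one for each level [t n]. The distance of two
    threads is the one seen at any coordinate where they differ, so it lies in the spectrum of some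
    [X n]. *)
Lemma inverse_limit_space : exists L : compact_ultrametric K,
  spec L `<=` \bigcup_n spec (X n) /\ forall n, coarsely_iso (t n) L (X n).
Proof.
have uX n := @cu_ultrametric _ (X n).
have t0 n := ltW (t_gt0 n).
have rhoP n := cid (separated_net (uX n) (t0 n)).
pose rho n := sval (rhoP n).
have rho_le n x : mdist x (rho n x) <= t n := (svalP (rhoP n)).1 x.
have rho_eq n x x' : mdist x x' <= t n -> rho n x = rho n x' :=
  (svalP (rhoP n)).2 x x'.
have rhorho n x : rho n (rho n x) = rho n x by apply/esym/rho_eq.
have hP n := cid (X_cauchy n).
(* Composing with [rho n] lands in the chosen representatives, so that compatibility in a thread is
   an equality and not merely closeness up to [t n]. *)
pose f n x := rho n (sval (hP n) x).
have f_max n x x' : Num.max (mdist (f n x) (f n x')) (t n) =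
    Num.max (mdist x x') (t n).
  by rewrite -(svalP (hP n)).1; apply: ultra_maxr; rewrite // metric_sym.
have f_le n x x' : mdist x x' <= t n -> f n x = f n x'.
  by move=> xx'; apply: rho_eq; rewrite (coarse_iso_le _ _ (svalP (hP n))).
have f_surj n y : rho n y = y -> exists x, rho n.+1 x = x /\ f n x = y.
  move=> yy; have [x xy] := (svalP (hP n)).2 y; exists (rho n.+1 x).
  split=> //; rewrite -(@f_le n x); first by rewrite /f -[RHS]yy; exact: rho_eq.
  by apply: le_trans (rho_le _ _) _; apply: t_noninc.
pose T := {a : forall n, cu_carrier (X n) |
  forall n, rho n (a n) = a n /\ f n (a n.+1) = a n}.
have T_max (p q : T) m n : (m <= n)%N ->
  Num.max (mdist (sval p n : X n) (sval q n)) (t m) =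
  Num.max (mdist (sval p m : X m) (sval q m)) (t m).
  elim: n => [|n IH]; first by rewrite leqn0 => /eqP ->.
  rewrite leq_eqVlt => /orP[/eqP -> //|]; rewrite ltnS => mn.
  rewrite -IH// -(svalP p n).2 -(svalP q n).2.
  exact/esym/(le_eq_maxr (t_noninc mn))/f_max.
have T_sep (p q : T) n :
    mdist (sval p n : X n) (sval q n) <= t n -> sval p n = sval q n.
  by move=> /rho_eq; rewrite (svalP p n).1 (svalP q n).1.
have T_eq (p q : T) : (forall n, sval p n = sval q n) -> p = q.
  case: p q => [a aP] [b bP] /= ab; apply: eq_exist.
  exact: functional_extensionality_dep.
(* Distinct representatives at level [n] are more than [t n] apart, hence [T_max] makes their
   distance the same at all later levels. *)
have T_dist (pq : T * T) : exists r,
    (exists n, r = mdist (sval pq.1 n : X n) (sval pq.2 n)) /\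
    forall n, Num.max r (t n) =
      Num.max (mdist (sval pq.1 n : X n) (sval pq.2 n)) (t n).
  case: pq => p q /=.
  have [pq|/existsNP[n pqn]] := pselect (forall n, sval p n = sval q n).
    exists 0; split=> [|n]; last by rewrite pq mdistxx.
    by exists 0%N; rewrite pq mdistxx.
  exists (mdist (sval p n : X n) (sval q n)); split=> [|m]; first by exists n.
  have [mn|/ltnW nm] := leqP m n; first exact: T_max.
  have /eq_maxrP[->//|[_ /T_sep/pqn//]] := T_max p q n m nm.
have /choice[D DP] := T_dist.
pose d p q := D (p, q).
have d_mdist p q : exists n, d p q = mdist (sval p n : X n) (sval q n) :=
  (DP (p, q)).1.
have d_max p q n : Num.max (d p q) (t n) =
  Num.max (mdist (sval p n : X n) (sval q n)) (t n) := (DP (p, q)).2 n.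
(* Comparison with [s] can be read at any coordinate whose level is at most [s]; this transfers the
   ultrametric axioms from the spaces [X n]. *)
have d_le p q n s : t n <= s ->
    (d p q <= s) = (mdist (sval p n : X n) (sval q n) <= s).
  move=> ts; have := congr1 (fun a => a <= s) (le_eq_maxr ts (d_max p q n)).
  by rewrite !ge_max lexx !andbT.
have d_ge0 p q : 0 <= d p q by have [n ->] := d_mdist p q; exact: mdist_ge0.
have d_eq0 p q : d p q = 0 -> p = q.
  move=> pq; apply: T_eq => n; apply: T_sep.
  by rewrite -(d_le p q n _ (lexx _)) pq.
have d_ultra p q r : d p r <= Num.max (d p q) (d q r).
  apply: le_inf_gt => s; rewrite gt_max => /andP[pqs qrs].
  have [n /ltW ns] := t_to0 (le_lt_trans (d_ge0 p q) pqs).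
  rewrite (d_le _ _ n)//; apply: (ultra_le (uX n) (y := sval q n)).
    by rewrite -d_le// ltW.
  by rewrite -d_le// ltW.
have d_sym p q : d p q = d q p.
  suff le p' q' : d p' q' <= d q' p' by apply/le_anti; rewrite !le.
  apply: le_inf_gt => s qps.
  have [n /ltW ns] := t_to0 (le_lt_trans (d_ge0 _ _) qps).
  by rewrite (d_le _ _ n)// metric_sym -d_le// ltW.
have dxx p : d p p = 0 by have [n ->] := d_mdist p p; exact: mdistxx.
have hd : is_metric d by exact: is_metric_ultra.
(* Each coordinate is constant on a set of the ultrafilter, and these constants form a thread, which
   is the limit. *)
have cT : compact [set: mspace hd].
  rewrite compact_ultra => G UG _.
  have /all_sig[x xP] : forall n, {x : X n |
      forall e, 0 < e -> G [set p : T | mdist (sval p n : X n) x < e]}.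
    move=> n; apply: cid.
    exact: (compact_ultra_lim (@cu_compact _ (X n))
      (fun p : T => sval p n : X n) UG).
  have Gx n : G [set p : T | sval p n = rho n (x n)].
    apply: filterS (xP n _ (t_gt0 n)) => p /= /ltW/rho_eq <-.
    exact/esym/(svalP p n).1.
  have bP n : rho n (rho n (x n)) = rho n (x n) /\
      f n (rho n.+1 (x n.+1)) = rho n (x n).
    split=> //; have [p [/= <- <-]] := filter_ex (filterI (Gx n) (Gx n.+1)).
    exact: (svalP p n).2.
  pose b : T := exist _ (fun n => rho n (x n)) bP.
  exists b; split=> //; apply/metricType_numDomainType.fcvgrPdist_lt => e e0.
  have [n ne] := t_to0 e0; apply: filterS (Gx n) => p /= pn.
  by apply: le_lt_trans ne; rewrite (d_le _ _ n)// pn mdistxx.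
have T_surj n (y : X n) : exists p : T, sval p n = rho n y.
  have [|||a [aP any]] :=
    @thread_through X (fun n x => rho n x = x) f n (rho n y).
  - by move=> m x _; exact: rhorho.
  - by move=> m z /f_surj.
  - exact: rhorho.
  - by exists (exist _ a aP).
have [x0 _] := cu_nonempty (X 0%N); have [p0 _] := T_surj _ x0.
exists (CompactUltrametric (d_ultra : ultrametric (mspace hd)) cT
  (ex_intro _ p0 I)); split=> [_ [p [q ->]]|n].
  have [n dn] := d_mdist p q; exists n => //.
  by exists (sval p n), (sval q n).
exists (fun p : T => sval p n); split=> [p q|y]; first by rewrite -d_max.
have [p pn] := T_surj n y; exists p; rewrite pn metric_sym; exact: rho_le.
Qed.

End InverseLimit.

(** * The space of isometry classes *)

Section DistanceMatrix.
Context {K : realType}.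

Definition dist_matrix (X : metricType K) (s : seq X) : seq (seq K) :=
  [seq [seq mdist x y | y <- s] | x <- s].

(** Send [x] to the point of [s'] with the same index as a point of [s] near [x]. Equal matrices
    preserve distances between net points, and truncation at [t] absorbs the displacement. *)
Lemma dist_matrix_coarse (X Y : metricType K) (x0 : X) (y0 : Y) (t : K)
    (s : seq X) (s' : seq Y) :
    ultrametric X -> ultrametric Y ->
    (forall x, exists2 y, y \in s & mdist x y <= t) ->
    (forall x, exists2 y, y \in s' & mdist x y <= t) ->
    dist_matrix s = dist_matrix s' ->
  coarsely_iso t X Y.
Proof.
move=> uX uY hs hs' E.
have /choice[near nearP] : forall x, exists y, y \in s /\ mdist x y <= t.
  by move=> x; have [y] := hs x; exists y.
have size_eq : size s = size s' by have := congr1 size E; rewrite !size_map.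
have nthE i j : (i < size s)%N -> (j < size s)%N ->
    mdist (nth y0 s' i) (nth y0 s' j) = mdist (nth x0 s i) (nth x0 s j).
  move=> si sj; have := congr1 (fun m => nth 0 (nth [::] m i) j) E.
  by rewrite !(nth_map x0)// !(nth_map y0) -?size_eq.
pose g x := nth y0 s' (index (near x) s).
have near_lt x : (index (near x) s < size s)%N by rewrite index_mem (nearP x).1.
have near_nth x : nth x0 s (index (near x) s) = near x.
  by rewrite nth_index ?(nearP x).1.
exists g; split=> [x x'|y].
  rewrite nthE// !near_nth; apply: ultra_maxr => //;
  by rewrite metric_sym (nearP _).2.
have [y' y's yy'] := hs' y.
have ys : (index y' s' < size s)%N by rewrite size_eq index_mem.
pose x := nth x0 s (index y' s').
exists x; apply: (ultra_le uY (y := y')); last by rewrite metric_sym.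
have := nthE _ _ (near_lt x) ys; rewrite (nth_index y0 y's) near_nth => ->.
rewrite metric_sym.
exact: (nearP _).2.
Qed.

End DistanceMatrix.

(** * The metric on isometry classes, its completeness and separability *)

Section UrysohnSpace.
Context {K : realType} (R : set K).

Lemma U_dist_ultra (c c' c'' : U_ R) :
  U_dist c c'' <= Num.max (U_dist c c') (U_dist c' c'').
Proof. exact: uGH_ultra. Qed.

Lemma U_dist_is_metric : is_metric (@U_dist K R).
Proof.
apply: is_metric_ultra (@U_dist_ultra) => [c c'|c|c c'|c c'].
- exact: uGH_ge0.
- exact: uGHxx.
- move=> /uGH_eq0 cc'; apply: val_inj.
  rewrite -[LHS]reprK -[RHS]reprK; apply/eqmodP; exact/asboolP.
- exact: uGHC.
Qed.

Let U : metricType K := mspace U_dist_is_metric.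

Let U_ultra : ultrametric U.
Proof. exact: U_dist_ultra. Qed.

(** Lets a constructed space stand for the representative of its class: the two are isometric, so at
    distance 0, and ultrametricity makes their distances to any [Y] equal. *)
Lemma U_class (X : compact_ultrametric K) : spec X `<=` R ->
  exists c : U_ R, forall Y, uGH (repr (val c)) Y = uGH X Y.
Proof.
move=> XR; pose c : isometry_class K := (\pi X)%qT.
have cX : isometricb (repr c) X by apply/eqmodP; rewrite reprK.
have /asboolP[g [[g' gK g'K] gi]] : isometricb X (repr c).
  by rewrite isometricb_sym.
move: cX => /asboolP[f [_ fi]].
have cR : U_ R c.
  by move=> _ [x [x' ->]]; apply: XR; rewrite -fi; exists (f x), (f x').
exists (exist _ c (mem_set cR)) => Y /=.
have Xc : uGH X (repr c) = 0.
  apply/le_anti; rewrite uGH_ge0 andbT; apply/uGH_leP => //.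
  exists g; split=> [x x'|y]; first by rewrite gi.
  by exists (g' y); rewrite g'K mdistxx.
apply/le_anti/andP; split.
  by apply: le_trans (uGH_ultra _ X _) _; rewrite uGHC Xc ge_max uGH_ge0 lexx.
by apply: le_trans (uGH_ultra _ (repr c) _) _; rewrite Xc ge_max uGH_ge0 lexx.
Qed.

Hypothesis R0 : R 0.

Lemma U_R_ultrametric : R_ultrametric R U.
Proof.
split=> [|_ [c [c' ->]]]; first exact: U_ultra.
have := mdist_ge0 c c'; rewrite le_eqVlt => /orP[/eqP <- //|].
by move=> /uGH_spec[]; [exact: (set_mem (valP c)) | exact: (set_mem (valP c'))].
Qed.

Lemma U_inhabited : exists c : U, True.
Proof.
pose d (_ _ : unit) : K := 0.
have hd : is_metric d 
  by apply: is_metric_ultra => // [[] []|? ? ?] //; rewrite /d maxxx.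
have ud : ultrametric (mspace hd) by move=> x y z; rewrite /mdist /= /d maxxx.
have cT : compact [set: mspace hd].
  rewrite compact_ultra => G UG _; exists tt; split=> //.
  apply/metricType_numDomainType.fcvgrPdist_lt => e e0.
  by apply: filterE => -[]; rewrite mdistxx.
have [|c _] := @U_class (CompactUltrametric ud cT (ex_intro _ tt I)).
  by move=> _ [x [y ->]].
by exists c.
Qed.

(** Take centres [x n] of balls of radius [1/(n+1)] in [F]. Consecutive balls meet, so the
    representatives form an inverse system up to [t n], whose limit space gives the limit of [F]. *)
Lemma U_complete : complete U.
Proof.
move=> F FF /cauchyP Fc.
pose t n : K := n.+1%:R^-1.
have t0 n : 0 < t n by rewrite invr_gt0.
have /choice[x xP] : forall n, exists x : U, F (ball x (t n)).
  by move=> n; exact: Fc.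
pose X n : compact_ultrametric K := repr (val (x n)).
have t_noninc m n : (m <= n)%N -> t n <= t m.
  by move=> mn; rewrite lef_pV2 ?posrE// ler_nat.
have t_to0 e : 0 < e -> exists n, t n < e.
  by move=> e0; have [k] := ltr_add_invr e0; rewrite add0r; exists k.
have [n|L [LX LP]] := @inverse_limit_space _ X t t0 t_noninc t_to0.
  have [y []] := filter_ex (filterI (xP n) (xP n.+1)).
  rewrite !ballEmdist /= => nx n1x; apply/uGH_leP; first exact: ltW.
  apply: (@ultra_le _ U U_ultra y (x n.+1) (x n)).
    by apply: le_trans (ltW n1x) _; exact: t_noninc.
  by rewrite metric_sym ltW.
have [|c cP] := @U_class L.
  by move=> r /LX[n _ Xr]; exact: (set_mem (valP (x n))) Xr.
exists (c : U); apply/metricType_numDomainType.fcvgrPdist_lt => e e0.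
have [n ne] := t_to0 _ e0; apply: filterS (xP n) => y.
rewrite ballEmdist /= => xy; apply: (ultra_lt U_ultra (y := x n)).
  apply: le_lt_trans ne; rewrite /mdist /= /U_dist cP.
  by apply/uGH_leP => //; exact: ltW.
exact: lt_trans ne.
Qed.

Hypothesis R_countable : countable R.

(* A finite [1/(k+1)]-net, with its matrix of distances coded by natural
   numbers, determines a space up to distance [1/(k+1)]. *)
Lemma U_separable : separable U.
Proof.
have /countable_injP[code code_inj] := R_countable.
pose decode n := xget 0 [set r | R r /\ code r = n].
have codeK r : R r -> decode (code r) = r.
  move=> Rr.
  have [Rs sr] : R (decode (code r)) /\ code (decode (code r)) = code r.
    by apply: (xgetPex 0 (P := [set s | R s /\ code s = code r])); exists r.
  by apply: code_inj => //; exact: mem_set.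
have [c0 _] := U_inhabited.
pose coded (q : nat * seq (seq nat)) : set U :=
  [set c : U_ R | exists2 s : seq (repr (val c) : compact_ultrametric K),
     forall x, exists2 y, y \in s & mdist x y <= q.1.+1%:R^-1 &
     dist_matrix s = map (map decode) q.2].
(* One class for each code, with [c0] for the codes that no class realizes. *)
exists (range (fun q => xget c0 (coded q))); split.
  exact: card_le_trans (card_image_le _ _) (countableP _).
move=> O [c Oc] Oopen.
have /nbhs_ballP[e /= e0 eO] : nbhs c O by exact: open_nbhs_nbhs.
have [k] := ltr_add_invr e0; rewrite add0r => ke.
have k0 : 0 < k.+1%:R^-1 :> K by rewrite invr_gt0.
have [s hs] := compact_net (@cu_compact _ (repr (val c))) k0.
pose q := (k, [seq [seq code (mdist x y) | y <- s] | x <- s]).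
have cq : coded q c.
  exists s => [x|]; first by have [y ys /ltW] := hs x; exists y.
  rewrite /= -map_comp; apply: eq_map => x /=; rewrite -map_comp.
  apply: eq_map => y /=; rewrite codeK//.
  by apply: (set_mem (valP c)); exists x, y.
pose c' := xget c0 (coded q); exists c'; split; last by exists q.
have [s' hs' ss'] : coded q c' by apply: xgetPex; exists c.
have [s'' hs'' ss''] := cq.
have [x0 _] := cu_nonempty (repr (val c)).
have [y0 _] := cu_nonempty (repr (val c')).
apply: eO; rewrite ballEmdist /=; apply: le_lt_trans ke.
apply/uGH_leP; first exact: ltW.
apply: (dist_matrix_coarse x0 y0 _ _ hs'' hs'); first exact: cu_ultrametric.
  exact: cu_ultrametric.
by rewrite ss''.
Qed.

(** * One-point extension, ultra-homogeneity and universality *)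

(** [s] is the graph of a finite partial isometric embedding; it is single-valued because points of
    [U] at distance 0 coincide. *)
Definition consistent (X : metricType K) (s : seq (X * U)) : Prop :=
  forall p q, p \in s -> q \in s -> mdist p.2 q.2 = mdist p.1 q.1.

(* By ultrametricity it suffices to realize the distance [r] of [x] to a
   nearest point [a] of [s], and to stay at distance at least [r] from the
   other points. *)
Lemma consistent_extend (X : metricType K) (s : seq (X * U)) (x : X) :
    ultrametric X -> spec X `<=` R -> consistent s ->
  exists u : U, consistent ((x, u) :: s).
Proof.
move=> uX XR cs.
suff [u uP] : exists u : U, forall p, p \in s -> mdist u p.2 = mdist x p.1.
  exists u => p q; rewrite !inE => /predU1P[->|ps] /predU1P[->|qs] /=.
  - by rewrite !mdistxx.
  - exact: uP.
  - by rewrite metric_sym uP// metric_sym.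
  - exact: cs.
case: s cs => [_|p0 s0 cs]; first by have [u _] := U_inhabited; exists u.
have [[a c] acs amin] := seq_argmin (fun p => mdist x p.1) p0 s0.
move: (p0 :: s0) => s in cs acs amin *; rewrite /= in amin.
have := mdist_ge0 x a; rewrite le_eqVlt => /orP[/eqP/esym/mdist_positivity xa|].
  by exists c => p ps; rewrite xa; exact: (cs (a, c) p).
set r := mdist x a => r0; have rR : R r by apply: XR; exists x, a.
have /choice[N NP] : forall p : X * U, exists N : nat,
    forall n (e : 'I_n -> (repr (val (p.2 : U_ R)) : compact_ultrametric K)),
    (forall i j, i != j -> r <= mdist (e i) (e j)) -> (n <= N)%N.
  move=> p; apply: packing_bound => //; first exact: cu_ultrametric.
  exact: cu_compact.
(* No space occurring in [s] holds [M.+1] points at mutual distance at least [r]. *)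
pose M := (\max_(p <- s) N p)%N.
have [Y [Yc YR [e eP]]] := branching_space (repr (val (c : U_ R))) M r0.
have [u uP] : exists u : U, forall Z, uGH (repr (val (u : U_ R))) Z = uGH Y Z.
  apply: (@U_class Y) => t /YR[|[->|->]]//; exact: (set_mem (valP c)).
(* A coarse isometry at a level below [r] would carry the [M.+1] branch points to points still [r]
   apart. *)
have u_ge p : p \in s -> r <= mdist u p.2.
  move=> ps; rewrite leNgt; apply/negP; rewrite /mdist /= /U_dist uP => lt_r.
  have [f [fE _]] := (uGH_leP Y (repr (val p.2)) (uGH_ge0 _ _)).1 (lexx _).
  suff : (M.+1 <= N p)%N.
    by rewrite ltnNge; apply/negP/negPn; exact: leq_bigmax_seq.
  apply: (NP p _ (f \o e)) => i j ij /=.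
  have /eq_maxrP[->|[_]] := fE (e i) (e j); rewrite eP//.
  by rewrite leNgt lt_r.
have u_le : mdist u c <= r.
  by rewrite /mdist /= /U_dist uP; apply/uGH_leP => //; exact: ltW.
exists u => p ps.
(* Both sides are at least [r], so they may be truncated at [r]; then [u] is replaced by [c] and [x]
   by [a], and consistency of [s] applies. *)
rewrite -(max_idPl (u_ge p ps)) -[RHS](max_idPl (amin p ps)).
rewrite (ultra_maxr U_ultra u_le (_ : mdist p.2 p.2 <= r)); last first.
  by rewrite mdistxx ltW.
rewrite (cs _ _ acs ps) (ultra_maxr uX (lexx r) (_ : mdist p.1 p.1 <= r))//.
by rewrite mdistxx ltW.
Qed.

(** The graph of [phi] is extended one point of [B] at a time. *)
Lemma U_ultra_homogeneous : R_ultra_homogeneous R U.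
Proof.
move=> B [uB BR] /finite_seqP[l lB] A phi phiP.
(* [F] extends [phi] arbitrarily outside [A], so that its graph can be listed along [l]. *)
have /choice[F FP] : forall b, exists u, forall a : A, val a = b -> phi a = u.
  move=> b; have [[a ab]|nb] := pselect (exists a : A, val a = b).
    by exists (phi a) => a'; rewrite -ab => /val_inj ->.
  by have [u _] := U_inhabited; exists u => a ab; case: nb; exists a.
have inl b : b \in l by have : [set: B] b by []; rewrite lB.
pose s0 := [seq (b, F b) | b <- l & `[< A b >]].
have s0P p : p \in s0 -> exists a : A, p = (val a, phi a).
  move=> /mapP[b]; rewrite mem_filter => /andP[/asboolP/mem_set Ab _] ->.
  by exists (exist _ b Ab); rewrite (FP b (exist _ b Ab)).
have s0c : consistent s0.
  by move=> p q /s0P[a ->] /s0P[a' ->]; exact: phiP.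
have in_s0 (a : A) : (val a, phi a) \in s0.
  apply/mapP; exists (val a); last by rewrite (FP (val a) a).
  by rewrite mem_filter inl andbT; apply/asboolP/set_mem/valP.
have [s [cs s0s sB]] : exists s, [/\ consistent s, {subset s0 <= s} &
    forall b, b \in l -> exists u, (b, u) \in s].
  move: (l) => l'; elim: l' => [|b l' [s [cs s0s sl]]].
    by exists s0; split.
  have [u cu] := consistent_extend b uB BR cs.
  exists ((b, u) :: s); split=> // [p /s0s ps|b']; first by rewrite inE ps orbT.
  rewrite inE => /predU1P[->|/sl[u' u's]]; first by exists u; exact: mem_head.
  by exists u'; rewrite inE u's orbT.
have /choice[psi psiP] : forall b, exists u, (b, u) \in s.
  by move=> b; exact: sB.
exists psi; split=> [b b'|a]; first exact: (cs (b, psi b) (b', psi b')).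
apply: mdist_positivity; rewrite (cs (val a, psi (val a)) (val a, phi a))//.
  exact: mdistxx.
exact: s0s.
Qed.

(** A dense sequence is embedded by successive one-point extensions, and the embedding extends to
    [X] by completeness of [U]. *)
Lemma U_universal : R_universal R U.
Proof.
move=> X [uX XR] [_ [D [cD dD]]].
have [[x0]|noX] := pselect (inhabited X); last first.
  have f (x : X) : U by case: noX.
  by exists f => x; case: noX.
have [e eP] : exists e : nat -> X,
    forall x r, 0 < r -> exists n, mdist x (e n) < r.
  have /countable_injP[code code_inj] := cD.
  exists (fun n => xget x0 [set x | D x /\ code x = n]) => x r r0.
  have [||z [/interior_subset xz Dz]] := dD (ball x r)^°.
  - by exists x; exact: nbhsx_ballx.
  - exact: open_interior.
  exists (code z); rewrite ballEmdist /= in xz.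
  set y := xget _ _; suff -> : y = z by [].
  have [Dy yz] : D y /\ code y = code z.
    by apply: (xgetPex x0 (P := [set y | D y /\ code y = code z])); exists z.
  by apply: code_inj => //; exact: mem_set.
have step n (s : {s | consistent (X := X) s}) :
    {s' : {s | consistent (X := X) s} | {subset sval s <= sval s'} &
      exists u, (e n, u) \in sval s'}.
  case: s => s cs; apply: cid2.
  have [u cu] := consistent_extend (e n) uX XR cs.
  exists (exist _ _ cu) => /= [p ps|]; first by rewrite inE ps orbT.
  by exists u; exact: mem_head.
have nilc : consistent (X := X) [::] by [].
(* An increasing chain of consistent graphs; [e n] enters at stage [n.+1]. *)
pose b := nat_rect (fun=> {s | consistent (X := X) s}) (exist _ _ nilc)
  (fun n s => s2val (step n s)).
have bS n : {subset sval (b n) <= sval (b n.+1)} := s2valP (step n (b n)).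
have bP n : exists u, (e n, u) \in sval (b n.+1) := s2valP' (step n (b n)).
have b_mono m n : (m <= n)%N -> {subset sval (b m) <= sval (b n)}.
  elim: n => [|n IH]; first by rewrite leqn0 => /eqP ->.
  rewrite leq_eqVlt => /orP[/eqP -> //|/IH mn p /mn]; exact: bS.
have /choice[phi phiP] := bP.
have phi_iso m n : mdist (phi m) (phi n) = mdist (e m) (e n).
  apply: (svalP (b (maxn m n).+1) (e m, phi m) (e n, phi n)).
    by apply: b_mono (phiP m); rewrite ltnS leq_maxl.
  by apply: b_mono (phiP n); rewrite ltnS leq_maxr.
have /choice[f fP] : forall x, exists u,
    forall n, mdist u (phi n) = mdist x (e n).
  move=> x.
  (* Generated by the images of the dense points close to [x]; its limit is the value of the
     embedding at [x]. *)
  pose F := [set A : set U | exists2 r, 0 < r &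
    forall n, mdist x (e n) < r -> A (phi n)].
  have FF : ProperFilter F.
    split; first by move=> [r r0 h]; have [n /h] := eP x r r0.
    split; first by exists 1.
      move=> A B [r r0 hA] [r' r'0 hB]; exists (Num.min r r').
        by rewrite lt_min r0.
      by move=> n; rewrite lt_min => /andP[/hA An /hB Bn].
    by move=> A B AB [r r0 hA]; exists r => // n /hA/AB.
  have [|u Fu] := U_complete FF.
    apply: cauchy_exP => r r0; have [n xn] := eP x r r0.
    exists (phi n), r => // m xm; rewrite ballEmdist /= phi_iso.
    by apply: (ultra_lt uX _ xm); rewrite metric_sym.
  exists u => n; apply: eq_mdist_inf => t t0.
  have [r r0 rt] := (metricType_numDomainType.fcvgrPdist_lt _).1 Fu t t0.
  have rt0 : 0 < Num.min r t by rewrite lt_min r0.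
  have [m] := eP x _ rt0; rewrite lt_min => /andP[/rt um xm].
  rewrite (ultra_maxr U_ultra (ltW um) (_ : mdist (phi n) (phi n) <= t)).
    2: by rewrite mdistxx ltW.
  rewrite phi_iso; apply: ultra_maxr => //; first by rewrite metric_sym ltW.
  by rewrite mdistxx ltW.
exists f => x x'; apply: eq_mdist_inf => t t0.
have [n xn] := eP x' t t0.
have fn : mdist (f x') (phi n) <= t by rewrite fP ltW.
rewrite (ultra_maxr U_ultra (_ : mdist (f x) (f x) <= t) fn); last first.
  by rewrite mdistxx ltW.
rewrite fP; apply: ultra_maxr => //; first by rewrite mdistxx ltW.
by rewrite metric_sym ltW.
Qed.

End UrysohnSpace.

Theorem theorem3p6 (K : realType) (R : set K) (R_countable : countable R)
    (R0 : R 0) (R_ge0 : forall r : K, R r -> 0 <= r) :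
  exists h : is_metric (@U_dist K R), R_Urysohn_universal R (mspace h).
Proof.
exists (@U_dist_is_metric K R); split.
- exact: U_R_ultrametric.
- by split; [exact: U_complete | exact: U_separable].
- exact: U_universal.
- exact: U_ultra_homogeneous.
Qed.
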